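(* Fix a real number $0<q<1$. Let $I(\mathbb{R})$ be a complex vector space of functions on the real line closed under Jackson integration and under multiplication by polynomial functions. The map $\iota:MW_q\to\mathrm{End}(I(\mathbb{R}))$ given on generators by $$(\iota(x)f)(x)=\int_0^x f(t)\,d_qt,\qquad (\iota(y)f)(x)=xf(x),\qquad \iota(q)f=qf\qquad (f\in I(\mathbb{R}))$$ defines a representation of $MW_q$ (i.e. extends to a homomorphism of complex algebras).
   Context: The $q$-meromorphic Weyl algebra is $MW_q=\mathbb{C}\langle x,y\rangle[q]/\langle yx-qxy-x^2\rangle$, where $\mathbb{C}\langle x,y\rangle[q]$ is the free associative complex algebra in the non-commuting variables $x,y$ with an adjoined formal variable $q$ that commutes with everything. In the formulas for $\iota$, the arguments $x,y,q$ of $\iota$ are the generators of $MW_q$, while elsewhere $x$ is the real coordinate and $q$ is the fixed real number. The Jackson integral of a function $f$ on $\mathbb{R}$ is $$\int_0^x f(t)\,d_qt=(1-q)x\sum_{n=0}^\infty q^nf(q^nx).$$ That $I(\mathbb{R})$ is closed under Jackson integration means that for every $f\in I(\mathbb{R})$ this series converges for every $x\in\mathbb{R}$ and the resulting function of $x$ lies in $I(\mathbb{R})$. $\mathrm{End}$ denotes the algebra of linear endomorphisms. *)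

(* Defs.v *)
From HB Require Import structures.
From mathcomp Require Import all_boot all_order all_algebra.
From mathcomp Require Import all_classical all_reals all_analysis.
From mathcomp Require Import complex.
(* The notations of monalg clash with those of mathcomp-analysis. *)
From mathcomp Require Import -(notations) monalg.

Set Implicit Arguments.
Unset Strict Implicit.
Unset Printing Implicit Defensive.

Import Order.TTheory GRing.Theory Num.Theory.
Import numFieldNormedType.Exports.

Local Open Scope classical_set_scope.
Local Open Scope quotient_scope.
Local Open Scope ring_scope.
Local Open Scope complex_scope.

(* The usual topology of C, that of the modulus; mathcomp-analysis only
   declares it on the alias R[i]^o. *)
HB.instance Definition _ (R : realType) := NormedModule.copy R[i] R[i]^o.

Section TwoSidedIdeal.
Variables (A : nzRingType) (r : A).

Definition ideal2_gen : {pred A} := fun u =>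
  `[< exists s : seq (A * A), u = \sum_(p <- s) p.1 * r * p.2 >].

Lemma ideal2_genP u : reflect
  (exists s : seq (A * A), u = \sum_(p <- s) p.1 * r * p.2) (u \in ideal2_gen).
Proof. exact: asboolP. Qed.

Fact ideal2_gen_zmod_closed : zmod_closed ideal2_gen.
Proof.
split=> [|u v /ideal2_genP[s ->] /ideal2_genP[t ->]]; apply/ideal2_genP.
  by exists [::]; rewrite big_nil.
exists (s ++ [seq (- p.1, p.2) | p <- t]).
rewrite big_cat big_map -sumrN; congr (_ + _).
by apply: eq_bigr => p _; rewrite !mulNr.
Qed.

HB.instance Definition _ :=
  GRing.isZmodClosed.Build A ideal2_gen ideal2_gen_zmod_closed.

Lemma ideal2_gen_mull a u : u \in ideal2_gen -> a * u \in ideal2_gen.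
Proof.
move=> /ideal2_genP[s ->]; apply/ideal2_genP.
exists [seq (a * p.1, p.2) | p <- s]; rewrite big_map mulr_sumr.
by apply: eq_bigr => p _; rewrite !mulrA.
Qed.

Lemma ideal2_gen_mulr a u : u \in ideal2_gen -> u * a \in ideal2_gen.
Proof.
move=> /ideal2_genP[s ->]; apply/ideal2_genP.
exists [seq (p.1, p.2 * a) | p <- s]; rewrite big_map mulr_suml.
by apply: eq_bigr => p _; rewrite !mulrA.
Qed.

Lemma ideal2_gen_self : r \in ideal2_gen.
Proof.
by apply/ideal2_genP; exists [:: (1, 1)]; rewrite big_seq1 mul1r mulr1.
Qed.

End TwoSidedIdeal.

Section MeromorphicWeyl.
Variable C : comNzRingType.

(* Words in two letters: false stands for x and true for y.  The
   indeterminate 'X of {poly _} commutes with everything; it stands for q. *)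
Definition free_alg : lalgType C := malg (fmonom bool) C.
Definition free_algq : nzRingType := {poly free_alg}.

Definition free_gen (b : bool) : free_alg := mkmalgU (fmu b) 1.

Definition fx : free_algq := (free_gen false)%:P.
Definition fy : free_algq := (free_gen true)%:P.
Definition fq : free_algq := 'X.
Definition fscalar (c : C) : free_algq := (c%:A)%:P.

Definition mw_rel : free_algq := fy * fx - fq * fx * fy - fx ^+ 2.

Definition mw_alg := {ideal_quot (ideal2_gen mw_rel)}.
HB.instance Definition _ := GRing.Zmodule.on mw_alg.

Definition mw_pi (u : free_algq) : mw_alg :=
  \pi_({ideal_quot (ideal2_gen mw_rel)}) u.

Lemma mw_pi_eq u v : mw_pi u = mw_pi v <-> u - v \in ideal2_gen mw_rel.
Proof. by rewrite Quotient.idealrBE; split=> [/eqP|/eqP]. Qed.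

Lemma mw_piK (a : mw_alg) : mw_pi (repr a) = a.
Proof. exact: reprK. Qed.

Fact mw_pi_is_zmod_morphism : zmod_morphism mw_pi.
Proof. exact: raddfB. Qed.
HB.instance Definition _ :=
  GRing.isZmodMorphism.Build _ _ mw_pi mw_pi_is_zmod_morphism.

Definition mw_one : mw_alg := mw_pi 1.
Definition mw_mul (a b : mw_alg) : mw_alg := mw_pi (repr a * repr b).

Lemma mw_pi_mul u v : mw_pi (u * v) = mw_mul (mw_pi u) (mw_pi v).
Proof.
have rK w : w - repr (mw_pi w) \in ideal2_gen mw_rel.
  by apply/mw_pi_eq; rewrite mw_piK.
apply/mw_pi_eq.
rewrite -[_ - _](subrKA (repr (mw_pi u) * v)) -mulrBl -mulrBr rpredD//.
  exact: ideal2_gen_mulr.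
exact: ideal2_gen_mull.
Qed.

Fact mw_mulA : associative mw_mul.
Proof.
move=> a b c; rewrite -[a]mw_piK -[b]mw_piK -[c]mw_piK.
by rewrite -!mw_pi_mul mulrA.
Qed.

Fact mw_mul1 : left_id mw_one mw_mul.
Proof. by move=> a; rewrite -[a]mw_piK -mw_pi_mul mul1r. Qed.

Fact mw_mulr1 : right_id mw_one mw_mul.
Proof. by move=> a; rewrite -[a]mw_piK -mw_pi_mul mulr1. Qed.

Fact mw_mulDl : left_distributive mw_mul +%R.
Proof.
move=> a b c; rewrite -[a]mw_piK -[b]mw_piK -[c]mw_piK.
by rewrite -raddfD -!mw_pi_mul mulrDl raddfD.
Qed.

Fact mw_mulDr : right_distributive mw_mul +%R.
Proof.
move=> a b c; rewrite -[a]mw_piK -[b]mw_piK -[c]mw_piK.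
by rewrite -raddfD -!mw_pi_mul mulrDr raddfD.
Qed.

(* The ideal is proper: it is killed by x, y, q |-> 0. *)
Fact mw_one_neq0 : mw_one != 0.
Proof.
pose ev (u : free_algq) : C := mcoeff (mone : fmonom bool) (u`_0).
have evM u v : ev (u * v) = ev u * ev v.
  by rewrite /ev coef0M; exact: (rmorphM (@mcoeff (fmonom bool) C mone)).
have evB u v : ev (u - v) = ev u - ev v.
  by rewrite /ev coefB; exact: (raddfB (@mcoeff (fmonom bool) C mone)).
have evD u v : ev (u + v) = ev u + ev v.
  by rewrite /ev coefD; exact: (raddfD (@mcoeff (fmonom bool) C mone)).
have ev0 : ev 0 = 0.
  by rewrite /ev coef0; exact: (raddf0 (@mcoeff (fmonom bool) C mone)).
have ev_gen b : ev (free_gen b)%:P = 0.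
  rewrite /ev coefC eqxx /free_gen mcoeffU.
  case: eqP => // /(congr1 (@fmonom_val bool)).
  by rewrite fm1 /fmu fmE.
have ev_rel : ev mw_rel = 0.
  rewrite /mw_rel; move: fx fy fq (ev_gen false : ev fx = 0) => X Y Q evX.
  rewrite evB evB evM (evM (Q * X)) (evM Q X) (evM X X) evX.
  by rewrite !mulr0 mul0r !subr0.
apply/eqP; rewrite -(raddf0 mw_pi) => /mw_pi_eq /ideal2_genP[s].
move=> /(congr1 ev); rewrite subr0.
have -> : ev (\sum_(p <- s) p.1 * mw_rel * p.2) = 0.
  elim: s => [|p s IHs]; first by rewrite big_nil.
  by rewrite big_cons evD IHs !evM ev_rel mulr0 mul0r addr0.
rewrite /ev coef1 eqxx.
have -> : mcoeff (mone : fmonom bool) (true%:R : free_alg) = 1.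
  exact: (rmorph1 (@mcoeff (fmonom bool) C mone)).
by move/eqP; rewrite oner_eq0.
Qed.

HB.instance Definition _ := GRing.Zmodule_isNzRing.Build mw_alg
  mw_mulA mw_mul1 mw_mulr1 mw_mulDl mw_mulDr mw_one_neq0.

Fact mw_pi_is_monoid_morphism : monoid_morphism mw_pi.
Proof. by split=> // u v; rewrite mw_pi_mul. Qed.
HB.instance Definition _ :=
  GRing.isMonoidMorphism.Build _ _ mw_pi mw_pi_is_monoid_morphism.

Fact free_scalar_comm (c : C) (g : free_alg) : g * c%:A = c%:A * g.
Proof.
rewrite mulr_algl -[1]/(mkmalgU (mone : fmonom bool) 1 : free_alg).
rewrite [g * _]malgM_def -mul_malgC [mkmalgU _ c * (mkmalgU _ 1)]malgM_def.
rewrite fgmulUU mulm1 mulr1 fgmulgU -mul_malgC malgM_def fgmulUg.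
by apply: eq_bigr => k _; rewrite mulm1 mul1m mulrC.
Qed.

Fact fscalar_comm (c : C) (u : free_algq) :
  u * fscalar c = fscalar c * u.
Proof.
by apply/polyP => i; rewrite /fscalar coefMC coefCM free_scalar_comm.
Qed.

Fact fscalarM c d : fscalar (c * d) = fscalar c * fscalar d.
Proof. by rewrite /fscalar -polyCM (mulr_algl c (d%:A : free_alg)) scalerA. Qed.

Fact fscalar1 : fscalar 1 = 1.
Proof. by rewrite /fscalar scale1r. Qed.

Fact fscalarD c d : fscalar (c + d) = fscalar c + fscalar d.
Proof. by rewrite /fscalar scalerDl polyCD. Qed.

Definition mw_scale (c : C) (a : mw_alg) : mw_alg := mw_pi (fscalar c) * a.

Fact mw_scaleA c d a : mw_scale c (mw_scale d a) = mw_scale (c * d) a.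
Proof.
rewrite /mw_scale fscalarM (rmorphM mw_pi).
exact: (mulrA (mw_pi (fscalar c)) (mw_pi (fscalar d)) a).
Qed.

Fact mw_scale1 : left_id 1 mw_scale.
Proof. by move=> a; rewrite /mw_scale fscalar1 (rmorph1 mw_pi) mul1r. Qed.

Fact mw_scaleDr : right_distributive mw_scale +%R.
Proof. by move=> c a b; exact: (mulrDr (mw_pi (fscalar c)) a b). Qed.

Fact mw_scaleDl a : {morph mw_scale^~ a : c d / c + d}.
Proof.
move=> c d; rewrite /mw_scale fscalarD (raddfD mw_pi).
exact: (mulrDl (mw_pi (fscalar c)) (mw_pi (fscalar d)) a).
Qed.

HB.instance Definition _ := GRing.Zmodule_isLmodule.Build C mw_alg
  mw_scaleA mw_scale1 mw_scaleDr mw_scaleDl.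

Fact mw_scaleAl (c : C) (a b : mw_alg) : c *: (a * b) = c *: a * b.
Proof. exact: (mulrA (mw_pi (fscalar c)) a b). Qed.
HB.instance Definition _ :=
  GRing.Lmodule_isLalgebra.Build C mw_alg mw_scaleAl.

Fact mw_scaleAr (c : C) (a b : mw_alg) : c *: (a * b) = a * (c *: b).
Proof.
have comm_c : mw_pi (fscalar c) * a = a * mw_pi (fscalar c).
  by rewrite -[a]mw_piK -!(rmorphM mw_pi) fscalar_comm.
transitivity (mw_pi (fscalar c) * a * b).
  exact: (mulrA (mw_pi (fscalar c)) a b).
by rewrite comm_c -(mulrA a (mw_pi (fscalar c)) b).
Qed.
HB.instance Definition _ :=
  GRing.Lalgebra_isAlgebra.Build C mw_alg mw_scaleAr.

Definition mw_x : mw_alg := mw_pi fx.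
Definition mw_y : mw_alg := mw_pi fy.
Definition mw_q : mw_alg := mw_pi fq.

Lemma mw_relE : mw_y * mw_x - mw_q * mw_x * mw_y - mw_x ^+ 2 = 0.
Proof.
have relM (A B : nzRingType) (g : {rmorphism A -> B}) x y q :
    g (y * x - q * x * y - x ^+ 2) =
    g y * g x - g q * g x * g y - g x ^+ 2.
  by rewrite !rmorphB rmorphXn !rmorphM.
transitivity (mw_pi mw_rel); first exact/esym/(relM _ _ mw_pi fx fy fq).
transitivity (mw_pi 0); last exact: (raddf0 mw_pi).
by apply/mw_pi_eq; rewrite subr0; exact: ideal2_gen_self.
Qed.

Lemma mw_q_central (a : mw_alg) : mw_q * a = a * mw_q.
Proof.
rewrite -[a]mw_piK /mw_q -!(rmorphM mw_pi); congr mw_pi.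
exact/esym/commr_polyX.
Qed.

End MeromorphicWeyl.

Section LinearEndomorphisms.
Variables (C : comNzRingType) (V : lmodType C).

(* A ring under composition, possibly the zero ring since V may be 0; this
   rules out an algType instance, whose laws are lend_scaleAl/lend_scaleAr. *)
Definition lend := {linear V -> V}.
HB.instance Definition _ := gen_eqMixin lend.
HB.instance Definition _ := gen_choiceMixin lend.

Lemma lendP (u v : lend) : (forall f, u f = v f) -> u = v.
Proof.
move=> E; have {}E : u = v :> (V -> V) by apply/funext.
case: u v E => [u [[a] [b]]] [v [[c] [d]]]; move=> /= E; subst v.
by rewrite (Prop_irrelevance c a) (Prop_irrelevance d b).
Qed.

Definition lend_zero : lend := \0 : {linear V -> V}.
Definition lend_opp (u : lend) : lend := (\- u) : {linear V -> V}.
Definition lend_add (u v : lend) : lend := (u \+ v) : {linear V -> V}.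
Definition lend_one : lend := idfun : {linear V -> V}.
Definition lend_mul (u v : lend) : lend := (u \o v) : {linear V -> V}.
Definition lend_scale (c : C) (u : lend) : lend := (c \*: u) : {linear V -> V}.

Fact lend_addA : associative lend_add.
Proof. by move=> u v w; apply/lendP => f; exact: addrA. Qed.
Fact lend_addC : commutative lend_add.
Proof. by move=> u v; apply/lendP => f; exact: addrC. Qed.
Fact lend_add0 : left_id lend_zero lend_add.
Proof. by move=> u; apply/lendP => f; exact: add0r. Qed.
Fact lend_addN : left_inverse lend_zero lend_opp lend_add.
Proof. by move=> u; apply/lendP => f; exact: addNr. Qed.
HB.instance Definition _ := GRing.isZmodule.Build lend
  lend_addA lend_addC lend_add0 lend_addN.

Fact lend_mulA : associative lend_mul.
Proof. by move=> u v w; apply/lendP. Qed.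
Fact lend_mul1 : left_id lend_one lend_mul.
Proof. by move=> u; apply/lendP. Qed.
Fact lend_mulr1 : right_id lend_one lend_mul.
Proof. by move=> u; apply/lendP. Qed.
Fact lend_mulDl : left_distributive lend_mul +%R.
Proof. by move=> u v w; apply/lendP. Qed.
Fact lend_mulDr : right_distributive lend_mul +%R.
Proof. by move=> u v w; apply/lendP => f; exact: (raddfD u). Qed.
HB.instance Definition _ := GRing.Zmodule_isPzRing.Build lend
  lend_mulA lend_mul1 lend_mulr1 lend_mulDl lend_mulDr.

Fact lend_scaleA c d u : lend_scale c (lend_scale d u) = lend_scale (c * d) u.
Proof. by apply/lendP => f; exact: scalerA. Qed.
Fact lend_scale1 : left_id 1 lend_scale.
Proof. by move=> u; apply/lendP => f; exact: scale1r. Qed.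
Fact lend_scaleDr : right_distributive lend_scale +%R.
Proof. by move=> c u v; apply/lendP => f; exact: scalerDr. Qed.
Fact lend_scaleDl u : {morph lend_scale^~ u : c d / c + d}.
Proof. by move=> c d; apply/lendP => f; exact: scalerDl. Qed.
HB.instance Definition _ := GRing.Zmodule_isLmodule.Build C lend
  lend_scaleA lend_scale1 lend_scaleDr lend_scaleDl.

Lemma lendM (u v : lend) f : (u * v) f = u (v f). Proof. by []. Qed.
Lemma lend1 f : (1 : lend) f = f. Proof. by []. Qed.
Lemma lendD (u v : lend) f : (u + v) f = u f + v f. Proof. by []. Qed.
Lemma lendZ c (u : lend) f : (c *: u) f = c *: u f. Proof. by []. Qed.

Lemma lend_scaleAl (c : C) (u v : lend) : c *: (u * v) = c *: u * v.
Proof. by apply/lendP. Qed.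
Lemma lend_scaleAr (c : C) (u v : lend) : c *: (u * v) = u * (c *: v).
Proof. by apply/lendP => f; exact: esym (linearZ_LR u c (v f)). Qed.

End LinearEndomorphisms.

Section JacksonIntegral.
Variable R : realType.

(* The summands q^n f(q^n x) of the Jackson integral of f from 0 to x. *)
Definition jackson_term (q : R) (f : R -> R[i]) (x : R) : nat -> R[i] :=
  fun n => (q ^+ n)%:C * f (q ^+ n * x).

Definition jackson (q : R) (f : R -> R[i]) : R -> R[i] :=
  fun x => ((1 - q) * x)%:C * limn (series (jackson_term q f x)).

Definition jackson_closed (q : R) (I : {pred (R -> R[i])}) : Prop :=
  forall f, f \in I ->
    (forall x, cvgn (series (jackson_term q f x))) /\ jackson q f \in I.

(* Polynomial functions have complex coefficients; as I is a complex subspace,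
   real coefficients would impose the same condition. *)
Definition poly_mul_closed (I : {pred (R -> R[i])}) : Prop :=
  forall (p : {poly R[i]}) f, f \in I -> (fun x => p.[x%:C] * f x) \in I.

Variable I : submodClosed (R -> R[i]).

Record funspace : predArgType :=
  Funspace { funspace_val :> R -> R[i]; _ : funspace_val \in I }.
HB.instance Definition _ := [isSub for funspace_val].
HB.instance Definition _ := [Choice of funspace by <:].
HB.instance Definition _ := [SubChoice_isSubLmodule of funspace by <:].

End JacksonIntegral.

(* Main.v *)
Require Import Defs.
From mathcomp Require Import all_boot all_order all_algebra.
From mathcomp Require Import all_classical all_reals all_analysis.
From mathcomp Require Import complex.
From HB Require Import structures.
From mathcomp Require Import -(notations) monalg.
From mathcomp Require Import ring.

(** The defining relation y x = q x y + x^2 of the algebra, read in the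
operators J (Jackson integration) and multiplication by t, says
  t * J f (t) = J (q t f + J f) (t),
and it is an integration by parts.  The Jackson integral inverts the
q-difference operator: F = J f satisfies
  F s - F (q s) = (1 - q) s f s              ([jackson_shift]),
and conversely a function F with these increments is J f as soon as F tends to
0 along q^n t, since the partial sums then telescope ([jackson_telescope]).
The q-Leibniz rule applied to s * J f s gives
  s J f s - q s J f (q s) = (1 - q) s (J f s + q s f s),
and q^n t J f (q^n t) tends to 0 because it is, up to the constant t, the
general term of the convergent series that defines J (J f) t.  Telescoping
gives the relation ([jackson_parts]); no double series is rearranged, so plain
convergence is enough.

The rest is the universal property of an algebra given by generators and one
relation: sending x and y to arbitrary elements of an algebra, and q to an
element that commutes with both, gives a morphism on the free algebra with q
adjoined, and it factors through the quotient exactly when it kills the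
relator ([mw_alg_universal], [mw_alg_rep]). *)

Set Implicit Arguments.
Unset Strict Implicit.
Unset Printing Implicit Defensive.

Import Order.TTheory GRing.Theory Num.Theory.
Import numFieldNormedType.Exports.

Local Open Scope ring_scope.
Local Open Scope complex_scope.

(** * Universal property of the meromorphic Weyl algebra *)

Lemma rmorph_ideal2_gen (A B : nzRingType) (g : {rmorphism A -> B}) (r u : A) :
  g r = 0 -> u \in ideal2_gen r -> g u = 0.
Proof.
move=> gr0 /ideal2_genP[s ->]; rewrite raddf_sum big1_seq //= => p _.
by rewrite !rmorphM gr0 mulr0 mul0r.
Qed.

(** Stated for arbitrary rings because the concrete ring of [mw_rel] is too deep
a construction for the morphism lemmas to be recognised inside it. *)
Lemma rmorph_mw_rel (A B : nzRingType) (g : {rmorphism A -> B}) (x y q : A) :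
  g (y * x - q * x * y - x ^+ 2) = g y * g x - g q * g x * g y - g x ^+ 2.
Proof. by rewrite !rmorphB rmorphXn !rmorphM. Qed.

Section UniversalProperty.
Variables (C : comNzRingType) (A : algType C) (x y q : A).

Definition word_eval (w : fmonom bool) : A :=
  \prod_(b <- w) (if b then y else x).

Fact word_eval_is_mmorphism : mmorphism word_eval.
Proof.
split=> [v w|]; rewrite /word_eval; last by rewrite fm1 big_nil.
by rewrite -big_cat; congr (\prod_(b <- _) _); rewrite fmM.
Qed.
HB.instance Definition _ :=
  monalg.isMultiplicative.Build (fmonom bool) A word_eval
    word_eval_is_mmorphism.

Definition free_eval : free_alg C -> A := mmap (in_alg A) word_eval.

HB.instance Definition _ := GRing.Additive.on free_eval.

Fact free_eval_is_monoid_morphism : monoid_morphism free_eval.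
Proof.
have commZ (g : free_alg C) v w :
    GRing.comm (in_alg A (mcoeff v g)) (word_eval w).
  by rewrite /GRing.comm /= mulr_algl mulr_algr.
by have [fM f1] := commr_mmap_is_multiplicative commZ.
Qed.
HB.instance Definition _ :=
  GRing.isMonoidMorphism.Build (free_alg C) A free_eval
    free_eval_is_monoid_morphism.

Lemma free_evalZ c g : free_eval (c *: g) = c *: free_eval g.
Proof. by rewrite /free_eval mmapZ /= mulr_algl. Qed.

Lemma free_eval_gen b : free_eval (free_gen C b) = if b then y else x.
Proof.
by rewrite /free_eval mmapU /= scale1r mul1r /word_eval /fmu fmE big_seq1.
Qed.

Hypotheses (qx : GRing.comm q x) (qy : GRing.comm q y).

Lemma free_eval_comm : commr_rmorph free_eval q.
Proof.
move=> g; rewrite /free_eval mmapE; apply: commr_sum => w _.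
apply: commrM; first by rewrite /GRing.comm /= mulr_algl mulr_algr.
by apply: commr_prod => -[] _.
Qed.

Definition freeq_eval : {rmorphism free_algq C -> A} :=
  horner_morph free_eval_comm.

Hypothesis xyq : y * x - q * x * y - x ^+ 2 = 0.

Lemma freeq_eval_rel : freeq_eval (mw_rel C) = 0.
Proof.
rewrite [LHS](rmorph_mw_rel freeq_eval) /=.
by rewrite /fq horner_morphX /fx /fy !horner_morphC /= !free_eval_gen.
Qed.

Lemma freeq_eval_eq u v : mw_pi u = mw_pi v -> freeq_eval u = freeq_eval v.
Proof.
move=> /mw_pi_eq/(rmorph_ideal2_gen freeq_eval_rel).
by rewrite rmorphB => /eqP; rewrite subr_eq0 => /eqP.
Qed.

End UniversalProperty.

(** Evaluation is well defined on classes by [freeq_eval_eq], so it can be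
computed on any representative; [repr] supplies one, and every law is inherited
from the free algebra by choosing representatives. *)
Lemma mw_alg_universal (C : comNzRingType) (A : algType C) (x y q : A) :
    GRing.comm q x -> GRing.comm q y -> y * x - q * x * y - x ^+ 2 = 0 ->
  exists phi : {lrmorphism mw_alg C -> A},
    [/\ phi (mw_x C) = x, phi (mw_y C) = y & phi (mw_q C) = q].
Proof.
move=> qx qy xyq; pose ev := freeq_eval qx qy.
pose phi (a : mw_alg C) : A := ev (repr a).
have phi_pi u : phi (mw_pi u) = ev u.
  by apply: freeq_eval_eq => //; rewrite mw_piK.
have phiB : zmod_morphism phi.
  move=> a b; rewrite -[a]mw_piK -[b]mw_piK -(raddfB (@mw_pi C)).
  by rewrite !phi_pi rmorphB.
have phiM : monoid_morphism phi.
  split=> [|a b]; first by rewrite -(rmorph1 (@mw_pi C)) phi_pi rmorph1.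
  rewrite -[a]mw_piK -[b]mw_piK -(rmorphM (@mw_pi C)).
  by rewrite !phi_pi rmorphM.
have phiZ : scalable phi.
  (* Scaling in the quotient is multiplication by the class of a constant. *)
  move=> c a; rewrite [c *: a]/(mw_pi (fscalar c) * a) phiM.2 phi_pi.
  by rewrite /ev /= /fscalar horner_morphC /= free_evalZ rmorph1 mulr_algl.
pose phiZm := GRing.isZmodMorphism.Build _ _ phi phiB.
pose phiMm := GRing.isMonoidMorphism.Build _ _ phi phiM.
pose phiSc := GRing.isScalable.Build C _ _ *:%R phi phiZ.
pose phi' : {lrmorphism mw_alg C -> A} := HB.pack phi phiZm phiMm phiSc.
exists phi'; split; rewrite [LHS]phi_pi /ev /=.
- by rewrite horner_morphC /= free_eval_gen.
- by rewrite horner_morphC /= free_eval_gen.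
- by rewrite horner_morphX.
Qed.

(** * Jackson calculus *)

Section JacksonCalculus.
Variables (R : realType) (q : R).
Implicit Types (f g F : R -> R[i]) (t : R).

Local Open Scope classical_set_scope.

(** The complex numbers have to be given by hand as a normed module over
themselves: unification does not find this structure and unfolds the topology
instead.  The next four lemmas do so once and for all. *)
Lemma cvgC_unique (u : nat -> R[i]) (a b : R[i]) :
  u n @[n --> \oo] --> a -> u n @[n --> \oo] --> b -> a = b.
Proof. exact: (@norm_cvg_unique R[i] R[i]). Qed.

Lemma cvgC_B (u v : nat -> R[i]) (a b : R[i]) :
  u n @[n --> \oo] --> a -> v n @[n --> \oo] --> b ->
  u n - v n @[n --> \oo] --> a - b.
Proof. exact: (@cvgB R[i] R[i]). Qed.

Lemma cvgC_D (u v : nat -> R[i]) (a b : R[i]) :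
  u n @[n --> \oo] --> a -> v n @[n --> \oo] --> b ->
  u n + v n @[n --> \oo] --> a + b.
Proof. exact: (@cvgD R[i] R[i]). Qed.

Lemma cvgC_Ml (k a : R[i]) (u : nat -> R[i]) :
  u n @[n --> \oo] --> a -> k * u n @[n --> \oo] --> k * a.
Proof. exact: (@cvgZl_tmp R[i] R[i]). Qed.

Lemma jackson_cvg f t : cvgn (series (jackson_term q f t)) ->
  ((1 - q) * t)%:C * series (jackson_term q f t) n @[n --> \oo] -->
    jackson q f t.
Proof. exact: cvgC_Ml. Qed.

(** A fundamental theorem of q-calculus: the n-th partial sum of the integral
telescopes to F t - F (q^n t). *)
Lemma jackson_telescope f F t :
    (forall s, F s - F (q * s) = ((1 - q) * s)%:C * f s) ->
    F (q ^+ n * t) @[n --> \oo] --> 0 ->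
    cvgn (series (jackson_term q f t)) ->
  jackson q f t = F t.
Proof.
move=> dF F0 /jackson_cvg Jf.
have E : (fun n => ((1 - q) * t)%:C * series (jackson_term q f t) n) =
         (fun n => F t - F (q ^+ n * t)).
  apply/funext => n; rewrite /series /= big_mkord mulr_sumr.
  elim: n => [|n IHn]; first by rewrite big_ord0 expr0 mul1r subrr.
  rewrite big_ord_recr /= IHn /jackson_term exprS -[q * _ * t]mulrA mulrA.
  rewrite -rmorphM /= -mulrA [t * _]mulrC.
  by rewrite -dF subrKA.
rewrite E in Jf; apply: (cvgC_unique Jf).
by rewrite -[X in _ --> X]subr0; exact: cvgC_B (cvg_cst _) F0.
Qed.

(** The integrals to t and to q t differ by the first term only, because the
series at q t is, up to the factor q, the tail of the series at t. *)
Lemma jackson_shift f t :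
    cvgn (series (jackson_term q f t)) ->
    cvgn (series (jackson_term q f (q * t))) ->
  jackson q f t - jackson q f (q * t) = ((1 - q) * t)%:C * f t.
Proof.
move=> ct cqt.
rewrite /jackson.
rewrite (_ : ((1 - q) * (q * t))%:C = ((1 - q) * t)%:C * q%:C); last first.
  by rewrite -rmorphM /= -mulrA [t * q]mulrC.
rewrite -mulrA -mulrBr; congr (_ * _).
apply/eqP; rewrite subr_eq addrC -subr_eq eq_sym; apply/eqP.
have E n : q%:C * series (jackson_term q f (q * t)) n =
    series (jackson_term q f t) n.+1 - f t.
  rewrite /series /= !big_mkord big_ord_recl /= /jackson_term expr0 !mul1r.
  rewrite addrC addKr mulr_sumr; apply: eq_bigr => i _.
  by rewrite /bump /= mulrA -rmorphM /= -exprS mulrA -exprSr.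
have qS : q%:C * series (jackson_term q f (q * t)) n @[n --> \oo]
    --> limn (series (jackson_term q f t)) - f t.
  under eq_fun do rewrite E.
  apply: cvgC_B (cvg_cst _).
  rewrite (cvg_shiftS (series (jackson_term q f t))); exact: ct.
exact: (cvgC_unique (cvgC_Ml (k := q%:C) cqt) qS).
Qed.

Lemma jackson_term_cvg0 f t : cvgn (series (jackson_term q f t)) ->
  jackson_term q f t n @[n --> \oo] --> 0.
Proof. exact: (@cvg_series_cvg_0 R[i] R[i]). Qed.

Lemma series_jackson_lin (a : R[i]) f g t :
    cvgn (series (jackson_term q f t)) -> cvgn (series (jackson_term q g t)) ->
  series (jackson_term q (a *: f + g) t) n @[n --> \oo] -->
    a * limn (series (jackson_term q f t)) + limn (series (jackson_term q g t)).
Proof.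
move=> cf cg.
rewrite (_ : series _ = fun n => a * series (jackson_term q f t) n +
                                 series (jackson_term q g t) n).
  exact: cvgC_D (cvgC_Ml cf) cg.
apply/funext => n; rewrite /series /= mulr_sumr -big_split /=.
by apply: eq_bigr => i _; rewrite /jackson_term mulrDr mulrCA.
Qed.

Lemma jackson_lin (a : R[i]) f g t :
    cvgn (series (jackson_term q f t)) -> cvgn (series (jackson_term q g t)) ->
  jackson q (a *: f + g) t = a * jackson q f t + jackson q g t.
Proof.
move=> cf cg; rewrite /jackson mulrCA -mulrDr; congr (_ * _).
have h := series_jackson_lin (a := a) cf cg.
exact: cvgC_unique (cvgP _ h) h.
Qed.

(** The relation of the algebra as an integration by parts: s |-> s J f s has the
q-increments of the integral of J f + q s f s, and it tends to 0 along q^n t. *)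
Lemma jackson_parts f :
    (forall t, cvgn (series (jackson_term q f t))) ->
    (forall t, cvgn (series (jackson_term q (jackson q f) t))) ->
    (forall t, cvgn (series (jackson_term q (fun s => s%:C * f s) t))) ->
  forall t, t%:C * jackson q f t - q%:C * jackson q (fun s => s%:C * f s) t
            - jackson q (jackson q f) t = 0.
Proof.
move=> cf cJf cyf t; apply/eqP; rewrite subr_eq0 subr_eq eq_sym addrC.
apply/eqP.
rewrite -jackson_lin; [|exact: cyf|exact: cJf].
have cyJ : cvgn (series
    (jackson_term q (q%:C *: (fun s => s%:C * f s) + jackson q f) t)).
  exact: cvgP (series_jackson_lin (cyf t) (cJf t)).
apply: (jackson_telescope (F := fun s => s%:C * jackson q f s) _ _ cyJ).
  move=> s.
  (* The q-Leibniz rule, by eliminating J f s. *)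
  have /eqP := jackson_shift (cf s) (cf (q * s)).
  rewrite subr_eq => /eqP E.
  rewrite -[X in _ = _ * X]/(q%:C * (s%:C * f s) + jackson q f s) E.
  by rewrite !rmorphM rmorphB rmorph1; ring.
(* The boundary term is t times the general term of the series of J (J f). *)
have -> : (fun n => (q ^+ n * t)%:C * jackson q f (q ^+ n * t)) =
          (fun n => t%:C * jackson_term q (jackson q f) t n).
  by apply/funext => n; rewrite /jackson_term rmorphM mulrA [t%:C * _]mulrC.
rewrite -[X in _ --> X](mulr0 t%:C).
exact: cvgC_Ml (jackson_term_cvg0 (cJf t)).
Qed.

End JacksonCalculus.

(** * Representations on endomorphism rings *)

Section NontrivialEndomorphisms.
Variables (C : comNzRingType) (V : lmodType C).
Hypothesis V_nontrivial : exists v : V, v != 0.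

(** Algebras are nontrivial rings, and [lend V] is one only when V is not 0; the
proof of this is a parameter of the type, so that the instances can use it. *)
Definition nzlend of (exists v : V, v != 0) := lend V.
Local Notation E := (nzlend V_nontrivial).

HB.instance Definition _ := GRing.PzRing.on E.
HB.instance Definition _ := GRing.Lmodule.on E.

Fact nzlend_oner_neq0 : (1 : E) != 0.
Proof.
case: V_nontrivial => v; apply: contra_neq => /(congr1 (fun u : lend V => u v)).
by [].
Qed.
HB.instance Definition _ :=
  GRing.PzSemiRing_isNonZero.Build E nzlend_oner_neq0.
HB.instance Definition _ :=
  GRing.Lmodule_isLalgebra.Build C E (@lend_scaleAl C V).
HB.instance Definition _ :=
  GRing.Lalgebra_isAlgebra.Build C E (@lend_scaleAr C V).

End NontrivialEndomorphisms.

(** The universal property for all endomorphism rings, the zero ring of a zero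
module included: there the zero map preserves 1. *)
Lemma mw_alg_rep (C : comNzRingType) (V : lmodType C) (x y q : lend V) :
    GRing.comm q x -> GRing.comm q y -> y * x - q * x * y - x ^+ 2 = 0 ->
  exists iota : {lrmorphism mw_alg C -> lend V},
    [/\ iota (mw_x C) = x, iota (mw_y C) = y & iota (mw_q C) = q].
Proof.
move=> qx qy xyq.
have [V1|V0] := pselect (exists v : V, v != 0).
  have [iota ?] := @mw_alg_universal C (nzlend V1) x y q qx qy xyq.
  by exists iota.
have lend0 (u v : lend V) : u = v.
  apply/lendP => f; apply/eqP/negPn/negP => uv; apply: V0.
  by exists (u f - v f); rewrite subr_eq0.
pose zero (_ : mw_alg C) : lend V := 0.
have zB : zmod_morphism zero by move=> a b; exact: lend0.
have zM : monoid_morphism zero by split=> [|a b]; exact: lend0.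
have zZ : scalable zero by move=> c a; exact: lend0.
pose zBm := GRing.isZmodMorphism.Build _ _ zero zB.
pose zMm := GRing.isMonoidMorphism.Build _ _ zero zM.
pose zZm := GRing.isScalable.Build C _ _ *:%R zero zZ.
pose iota : {lrmorphism mw_alg C -> lend V} := HB.pack zero zBm zMm zZm.
by exists iota; split; exact: lend0.
Qed.

Theorem theorem6 (R : realType) (q : R) (hq : 0 < q < 1)
    (I : submodClosed (R -> R[i]))
    (hJ : jackson_closed q I) (hP : poly_mul_closed I) :
  exists iota : {lrmorphism mw_alg R[i] -> lend (funspace I)},
    forall f : funspace I,
      [/\ forall t : R, iota (mw_x R[i]) f t = jackson q f t,
          forall t : R, iota (mw_y R[i]) f t = t%:C * f t
        & iota (mw_q R[i]) f = q%:C *: f].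
Proof.
have fI (f : funspace I) : (f : R -> R[i]) \in I := valP f.
have cvgJ f t : f \in I -> cvgn (series (jackson_term q f t)).
  by move=> /hJ[+ _]; exact.
have JI f : f \in I -> jackson q f \in I by move=> /hJ[].
have yI f : f \in I -> (fun t => t%:C * f t) \in I.
  move=> /(hP 'X); congr (_ \in I); apply/funext => t.
  by rewrite hornerX.
pose J (f : funspace I) : funspace I := Funspace (JI _ (fI f)).
pose Y (f : funspace I) : funspace I := Funspace (yI _ (fI f)).
have Jlin : linear J.
  move=> a f g; apply/val_inj/funext => t /=.
  exact: jackson_lin (cvgJ _ t (fI f)) (cvgJ _ t (fI g)).
have Ylin : linear Y.
  move=> a f g; apply/val_inj/funext => t /=.
  by rewrite -[LHS]/(t%:C * (a * f t + g t)) mulrDr mulrCA.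
pose Jm := GRing.isLinear.Build _ _ _ _ J Jlin.
pose Ym := GRing.isLinear.Build _ _ _ _ Y Ylin.
pose x : lend (funspace I) := HB.pack_for (lend (funspace I)) J Jm.
pose y : lend (funspace I) := HB.pack_for (lend (funspace I)) Y Ym.
pose qq : lend (funspace I) := q%:C *: (1 : lend (funspace I)).
have qE u : qq * u = q%:C *: u by rewrite /qq -lend_scaleAl mul1r.
have qC u : GRing.comm qq u.
  by rewrite /GRing.comm qE /qq -lend_scaleAr mulr1.
have xyq : y * x - qq * x * y - x ^+ 2 = 0.
  rewrite qE; apply/lendP => f; apply/val_inj/funext => t.
  apply: jackson_parts.
  - by move=> s; exact: cvgJ.
  - by move=> s; exact: cvgJ (JI _ (fI f)).
  - by move=> s; exact: cvgJ (yI _ (fI f)).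
have [iota [ix iy iq]] := mw_alg_rep (qC x) (qC y) xyq.
exists iota => f; split=> [t|t|].
- by rewrite ix.
- by rewrite iy.
- by rewrite iq.
Qed.
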